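(* Let $\kappa$ be a cardinal satisfying $cf(\kappa)>\omega_1$. Suppose that $X$ is a Banach space of density $\kappa$ such that $X^*$ contains a nonseparable WLD subspace. Then $X$ does not admit an overcomplete set.
   Context: All Banach spaces are infinite dimensional and over the reals. $dens(X)$ (the density) is the minimal cardinality of a norm dense subset of $X$; $cf(\kappa)$ is the cofinality of $\kappa$. A subset $Y$ of a Banach space $X$ is called overcomplete (in $X$) if $|Y|=dens(X)$ and every $Z\subseteq Y$ with $|Z|=|Y|$ is linearly dense in $X$ (its linear span is norm dense in $X$). A Banach space $W$ is WLD (weakly Lindelöf determined) if it admits a linearly dense set $D\subseteq W$ such that $\{d\in D: w^*(d)\neq 0\}$ is countable for each $w^*\in W^*$. *)

(* Defs.v *)
From HB Require Import structures.
From mathcomp Require Import all_boot all_order all_algebra.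
From mathcomp Require Import boolp classical_sets functions cardinality wochoice.
From mathcomp Require Import reals topology normedtype.

Set Implicit Arguments.
Unset Strict Implicit.
Unset Printing Implicit Defensive.

Import Order.TTheory GRing.Theory Num.Theory.
Import numFieldNormedType.Exports.

Local Open Scope classical_set_scope.
Local Open Scope card_scope.
Local Open Scope ring_scope.

(* The Banach dual X^*: continuous linear functionals with the operator norm. *)
Section Dual.
Context {R : realType} {X : normedModType R}.

Definition dual_pred : {pred X -> R^o} :=
  fun f => `[< linear f /\ continuous f >].

Record dual := Dual {
  dual_fun :> X -> R^o;
  dual_funP : dual_fun \in dual_pred }.

HB.instance Definition _ := [isSub for dual_fun].
HB.instance Definition _ := [Choice of dual by <:].

Lemma dual_submod_closed : submod_closed dual_pred.
Proof.
split.
  apply/asboolP; split; first by move=> a u v; rewrite /= scaler0 addr0.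
  by move=> x; exact: cvg_cst.
move=> a f g /asboolP[lf cf] /asboolP[lg cg]; apply/asboolP; split.
  move=> b u v; rewrite !fctE lf lg !scalerDr !scalerA (mulrC a b).
  by rewrite addrACA.
move=> x; apply: (@cvgD _ R^o); last exact: cg.
by apply: (@cvgZl_tmp _ R^o); exact: cf.
Qed.

HB.instance Definition _ :=
  GRing.isSubmodClosed.Build R (X -> R^o) dual_pred dual_submod_closed.
HB.instance Definition _ := [SubChoice_isSubLmodule of dual by <:].

Lemma dual_linear (f : dual) : linear f.
Proof. by case/asboolP: (dual_funP f). Qed.

Lemma dual_continuous (f : dual) : continuous f.
Proof. by case/asboolP: (dual_funP f). Qed.

HB.instance Definition _ (f : dual) :=
  GRing.isLinear.Build R X R^o *:%R f (dual_linear f).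


Definition dual_norm (f : dual) : R :=
  sup [set `|f x| | x in [set x : X | `|x| <= 1]].

Lemma dual_has_sup (f : dual) :
  has_sup [set `|f x| | x in [set x : X | `|x| <= 1]].
Proof.
split; first by exists `|f 0|; exists 0 => //=; rewrite normr0.
have /linear_bounded_continuous/linear_boundedP := @dual_continuous f.
move=> /pinfty_ex_gt0[r r0 fr]; exists r => _ [x /= x1 <-].
by rewrite (le_trans (fr x))// ler_piMr// ltW.
Qed.

Lemma le_dual_norm (f : dual) (x : X) : `|f x| <= dual_norm f * `|x|.
Proof.
have [->|x0] := eqVneq x 0; first by rewrite linear0 !normr0 mulr0.
rewrite -ler_pdivrMr ?normr_gt0//; apply: ub_le_sup.
  by case: (dual_has_sup f).
exists (`|x|^-1 *: x); last first.
  by rewrite linearZ/= normrZ normrV ?unitfE ?normr_eq0// normr_id mulrC.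
by rewrite /= normrZ normrV ?unitfE ?normr_eq0// normr_id mulVf// normr_eq0.
Qed.

Lemma dual_norm_le (f : dual) (M : R) :
  0 <= M -> (forall x, `|f x| <= M * `|x|) -> dual_norm f <= M.
Proof.
move=> M0 fM; apply: ge_sup; first by case: (dual_has_sup f).
by move=> _ [x /= x1 <-]; rewrite (le_trans (fM x))// ler_piMr.
Qed.

Lemma dual_norm_ge0 (f : dual) : 0 <= dual_norm f.
Proof.
apply: ub_le_sup; first by case: (dual_has_sup f).
by exists 0; rewrite /= ?linear0 normr0.
Qed.

Lemma ler_dual_normD (f g : dual) :
  dual_norm (f + g) <= dual_norm f + dual_norm g.
Proof.
apply: dual_norm_le; first by rewrite addr_ge0// dual_norm_ge0.
move=> x; rewrite mulrDl (le_trans (ler_normD (f x) (g x)))//.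
by rewrite lerD// le_dual_norm.
Qed.

Lemma dual_normZ (a : R) (f : dual) : dual_norm (a *: f) = `|a| * dual_norm f.
Proof.
have le b g : dual_norm (b *: g) <= `|b| * dual_norm g.
  apply: dual_norm_le; first by rewrite mulr_ge0// dual_norm_ge0.
  move=> x; rewrite -mulrA (_ : (b *: g) x = b * g x)//.
  by rewrite normrM ler_wpM2l// le_dual_norm.
apply/eqP; rewrite eq_le le /=.
have [->|a0] := eqVneq a 0; first by rewrite normr0 mul0r dual_norm_ge0.
rewrite -ler_pdivlMl ?normr_gt0// -normfV -{1}(scalerK a0 f); exact: le.
Qed.

Lemma dual_norm0_eq0 (f : dual) : dual_norm f = 0 -> f = 0.
Proof.
move=> f0; apply/val_inj/funext => x /=; apply/normr0_eq0/eqP.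
by rewrite eq_le normr_ge0 andbT (le_trans (le_dual_norm f x))// f0 mul0r.
Qed.

HB.instance Definition _ := Lmodule_isNormed.Build R dual
  ler_dual_normD dual_normZ dual_norm0_eq0.

Lemma dual_normE (f : dual) : `|f| = dual_norm f. Proof. by []. Qed.

Lemma dual_complete (F : set_system dual) :
  ProperFilter F -> cauchy F -> cvg F.
Proof.
move=> FF /cauchyP Fc.
have Fe (e : R) : 0 < e -> exists2 A, F A &
    forall (f g : dual) x, A f -> A g -> `|f x - g x| <= e * `|x|.
  move=> e0; have e20 : 0 < e / 2 by rewrite divr_gt0.
  have [h Fh] := Fc _ e20; exists (ball h (e / 2)) => // f g x hf hg.
  rewrite (le_trans (le_dual_norm (f - g) x))// ler_wpM2r// ltW//.
  have : ball f e g by apply: (ball_splitr hf hg).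
  by rewrite -ball_normE.
have Fx (x : X) : cvg ((fun f : dual => f x : R^o) @ F).
  apply: cauchy_cvg; apply/cauchyP => e e0.
  have d0 : 0 < e / (`|x| + 1) by rewrite divr_gt0// ltr_wpDl.
  have [A FA Ae] := Fe _ d0; have [f Af] := filter_ex FA.
  exists (f x).
  change (F [set g : dual | ball (f x : R^o) e (g x : R^o)]).
  apply: filterS FA => g Ag /=.
  rewrite -ball_normE /= (le_lt_trans (Ae f g x Af Ag))//.
  by rewrite mulrAC -mulrA gtr_pMr// ltr_pdivrMr ?mul1r ?ltrDl// ltr_wpDl.
pose l (x : X) : R^o := lim ((fun f : dual => f x : R^o) @ F).
have ll : linear l.
  move=> a u v; apply: cvg_lim => //.
  rewrite (_ : (fun f : dual => _) = (fun f : dual => a *: (f u : R^o) + f v)).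
    by apply: cvgD; [apply: cvgZl_tmp|]; exact: Fx.
  by apply/funext => f; rewrite linearP.
have Fl (e : R) : 0 < e -> exists2 A, F A &
    forall (f : dual) x, A f -> `|l x - f x| <= e * `|x|.
  move=> e0; have [A FA Ae] := Fe _ e0; exists A => // f x Af.
  have lf : (fun g : dual => `|(g x : R^o) - f x|) @ F --> `|l x - f x|.
    by apply: cvg_norm; apply: cvgB; [exact: Fx|exact: cvg_cst].
  apply: (cvgr_to_le lf).
  by apply: filterS FA => g Ag; exact: Ae.
pose L : {linear X -> R^o} := HB.pack l (GRing.isLinear.Build _ _ _ _ l ll).
have lc : continuous l.
  have [A FA Ae] := Fl 1 ltr01; have [f Af] := filter_ex FA.
  apply: (@bounded_linear_continuous _ _ _ L); apply/linear_boundedP.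
  near=> r => x; rewrite -(subrK (f x) (L x)).
  rewrite (le_trans (ler_normD _ _))//.
  rewrite (@le_trans _ _ ((1 + dual_norm f) * `|x|))//.
    by rewrite mulrDl lerD ?le_dual_norm//; exact: Ae.
  by rewrite ler_wpM2r//; near: r; apply: nbhs_pinfty_ge; rewrite num_real.
have lP : l \in dual_pred by apply/asboolP.
apply/cvg_ex; exists (Dual lP); apply/cvgrPdist_le => e e0.
have [A FA Ae] := Fl _ e0; apply: filterS FA => f Af.
by rewrite dual_normE; apply: dual_norm_le; [exact: ltW|move=> x; exact: Ae].
Unshelve. all: by end_near. Qed.

HB.instance Definition _ := Uniform_isComplete.Build dual dual_complete.

End Dual.
Arguments dual_pred {R} X.
Arguments dual {R} X.

(* A closed linear subspace of a Banach space, coerced to the Banach space that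
   it is for the restricted norm. *)
Section ClosedSubspace.
Context {R : realType} {E : completeNormedModType R}.

Record closed_subspace := ClosedSubspace {
  subspace_set : set E;
  subspace0 : subspace_set 0;
  subspaceP : forall (a : R) (x y : E),
    subspace_set x -> subspace_set y -> subspace_set (a *: x + y);
  subspace_closed : closed subspace_set }.

Section Sort.
Context (W : closed_subspace).

Definition subspace_pred : {pred E} := fun x => `[< subspace_set W x >].

Record subspace_sort := SubspaceElt {
  subspace_val :> E;
  subspace_valP : subspace_val \in subspace_pred }.

HB.instance Definition _ := [isSub for subspace_val].
HB.instance Definition _ := [Choice of subspace_sort by <:].

Lemma subspace_submod_closed : submod_closed subspace_pred.
Proof.
split; first by apply/asboolP; exact: subspace0.
by move=> a x y /asboolP Wx /asboolP Wy; apply/asboolP; exact: subspaceP.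
Qed.

HB.instance Definition _ :=
  GRing.isSubmodClosed.Build R E subspace_pred subspace_submod_closed.
HB.instance Definition _ := [SubChoice_isSubLmodule of subspace_sort by <:].

Definition subspace_norm (w : subspace_sort) : R := `|subspace_val w|.

Lemma ler_subspace_normD (v w : subspace_sort) :
  subspace_norm (v + w) <= subspace_norm v + subspace_norm w.
Proof. exact: ler_normD. Qed.

Lemma subspace_normZ (a : R) (w : subspace_sort) :
  subspace_norm (a *: w) = `|a| * subspace_norm w.
Proof. exact: normrZ. Qed.

Lemma subspace_norm0_eq0 (w : subspace_sort) : subspace_norm w = 0 -> w = 0.
Proof. by move=> w0; apply/val_inj; exact: normr0_eq0. Qed.

HB.instance Definition _ := Lmodule_isNormed.Build R subspace_sort
  ler_subspace_normD subspace_normZ subspace_norm0_eq0.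

Lemma subspace_complete (F : set_system subspace_sort) :
  ProperFilter F -> cauchy F -> cvg F.
Proof.
move=> FF /cauchyP Fc.
have /cvg_ex[/= l Fl] : cvg (subspace_val @ F).
  apply: cauchy_cvg; apply/cauchyP => e e0; have [w Fw] := Fc _ e0.
  exists (subspace_val w).
  change (F [set v | ball (subspace_val w) e (subspace_val v)]).
  by apply: filterS Fw => v; rewrite -!ball_normE.
have lW : l \in subspace_pred.
  apply/asboolP; apply: (closed_cvg _ (@subspace_closed W) _ _ Fl).
  by apply: nearW => w; apply/asboolP; exact: subspace_valP.
apply/cvg_ex; exists (SubspaceElt lW); apply/cvgrPdist_le => e e0.
by move/cvgrPdist_le : Fl => /(_ _ e0).
Qed.

HB.instance Definition _ :=
  Uniform_isComplete.Build subspace_sort subspace_complete.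

End Sort.
End ClosedSubspace.
Arguments closed_subspace {R} E.
Coercion subspace_sort : closed_subspace >-> Sortclass.

Section BanachSpaces.
Context {R : realType}.
Implicit Type X : completeNormedModType R.

Definition linear_span X (A : set X) : set X :=
  [set x | exists (n : nat) (a : 'I_n -> R) (v : 'I_n -> X),
     (forall i, A (v i)) /\ x = \sum_(i < n) a i *: v i].

Definition linearly_dense X (A : set X) : Prop := dense (linear_span A).

Definition infinite_dimensional X : Prop :=
  forall A : set X, finite_set A -> linear_span A <> [set: X].

Definition separable X : Prop := exists2 A : set X, countable A & dense A.

(* The density of X is |K|. *)
Definition dens_eq X (T : Type) (K : set T) : Prop :=
  (exists2 A : set X, dense A & A #= K) /\
  (forall A : set X, dense A -> K #<= A).

Definition overcomplete X (Y : set X) : Prop :=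
  dens_eq X Y /\
  (forall Z : set X, Z `<=` Y -> Z #= Y -> linearly_dense Z).

Definition WLD X : Prop :=
  exists2 D : set X, linearly_dense D &
    forall f : dual X, countable [set d | D d /\ f d <> 0].

End BanachSpaces.

(* A cardinal is given as an initial ordinal, that is, by a well-ordered type
   (le is the reflexive order) equipotent to none of its proper initial
   segments. *)
Section Cardinals.

Definition initial_segment (T : Type) (le : rel T) (x : T) : set T :=
  [set y | ~~ le x y].

Definition is_cardinal (T : Type) (le : rel T) : Prop :=
  well_order le /\ (forall x, initial_segment le x #!= [set: T]).

Definition card_lt (T U : Type) (A : set T) (B : set U) : Prop :=
  A #<= B /\ ~~ (B #<= A).

Definition cofinal (T : Type) (le : rel T) (A : set T) : Prop :=
  forall x, exists2 a, A a & le x a.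

(* The cofinality of (T, le) is |C|. *)
Definition cf_eq (T : Type) (le : rel T) (U : Type) (C : set U) : Prop :=
  (exists2 A : set T, cofinal le A & A #= C) /\
  (forall A : set T, cofinal le A -> C #<= A).

(* In a well-order of an uncountable type, the elements with countably many
   predecessors form an initial segment of order type omega_1. *)
Definition omega1 : set (set nat) :=
  [set x | countable
    (initial_segment (sval (well_ordering_principle (set nat))) x)].

Lemma omega1_uncountable : ~ countable omega1.
Proof.
have setN : ~ countable [set: set nat].
  move=> /countable_injP[f] /in2TT fI.
  pose D : set nat := [set n | exists2 A : set nat, f A = n & ~ A n].
  have : ~ D (f D) by move=> /[dup] DD [A /fI ->].
  by move=> nD; apply: (nD); exists D.
rewrite /omega1; case: well_ordering_principle => le /= wo.
set O := [set x | _] => Oc.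
have [x nOx] : exists x, ~ O x.
  apply/existsNP => OT; apply: setN; apply: sub_countable Oc.
  exact: subset_card_le.
have [|m [[/asboolP nOm mmin] _]] := wo (fun x => `[< ~ O x >]).
  by exists x; apply/asboolP.
apply: nOm; apply: sub_countable Oc; apply: subset_card_le => y /= mNy.
by apply: contrapT => nOy; move/negP: mNy; apply; apply: mmin; apply/asboolP.
Qed.

End Cardinals.

(* Main.v *)
(* Weak Lindelof determination yields uncountably many, but at most omega_1,
   nonzero functionals in W such that each x in X is annihilated by all but
   countably many of them. Given an overcomplete Y, map each y in Y to one of
   these functionals annihilating y: as cf kappa > omega_1, some fibre Z has
   cardinality kappa, and Z lies in the kernel of a nonzero functional, so Z is
   not linearly dense. *)
From HB Require Import structures.
Require Import Defs.
From mathcomp Require Import all_boot all_order all_algebra.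
From mathcomp Require Import boolp classical_sets functions cardinality wochoice.
From mathcomp Require Import reals topology normedtype.

Set Implicit Arguments.
Unset Strict Implicit.
Unset Printing Implicit Defensive.

Import Order.TTheory GRing.Theory Num.Theory.
Import numFieldNormedType.Exports.

(** * Order axioms derived from least elements *)

Section WellOrders.
Local Open Scope classical_set_scope.
Context {T : Type} {le : rel T}.
Hypothesis le_wo : well_order le.

Lemma well_order_min (P : set T) :
  P !=set0 -> exists2 z, P z & forall x, P x -> le z x.
Proof.
move=> [x Px]; have [|z [[/asboolP Pz zmin] _]] := le_wo (A := fun x => `[< P x >]).
  by exists x; apply/asboolP.
by exists z => // y Py; apply: zmin; apply/asboolP.
Qed.

Lemma well_order_refl : reflexive le.
Proof. by move=> x; have [|_ -> ->//] := @well_order_min [set x]; exists x. Qed.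

(** Both points are least in the pair [{x, y}], and [well_order] makes least elements unique. *)
Lemma well_order_antisym : antisymmetric le.
Proof.
move=> x y /andP[xy yx].
have [|z [_ zuniq]] := le_wo (A := fun u => `[< u = x \/ u = y >]).
  by exists x; apply/asboolP; left.
rewrite -(zuniq x) ?(zuniq y)//; split; try by apply/asboolP; auto.
- by move=> u /asboolP[->|->]//; exact: well_order_refl.
- by move=> u /asboolP[->|->]//; exact: well_order_refl.
Qed.

Lemma well_order_total : total le.
Proof.
move=> x y; have [|z [->|->] zmin] := @well_order_min [set u | u = x \/ u = y].
- by exists x; left.
- by rewrite zmin//; right.
- by rewrite (zmin x) ?orbT//; left.
Qed.

(** Take the least of [x], [y], [z]: if it is [y] or [z], antisymmetry identifies it with its
    predecessor in the chain. *)
Lemma well_order_trans : transitive le.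
Proof.
move=> y x z xy yz.
have [|u + umin] := @well_order_min [set u | [\/ u = x, u = y | u = z]].
  by exists x; apply: Or31.
have ux := umin x (Or31 _ _ erefl); have uy := umin y (Or32 _ _ erefl).
have uz := umin z (Or33 _ _ erefl).
move=> [uE|uE|uE]; subst u => //.
- by rewrite -(well_order_antisym (x := y) (y := x)) ?ux.
- by rewrite (well_order_antisym (x := z) (y := y)) ?uy.
Qed.

End WellOrders.

(** * Comparability, squares and cofinality of cardinals *)

Section CardinalArithmetic.
Local Open Scope classical_set_scope.
Local Open Scope card_scope.

Lemma card_le_of_inj {T U : Type} {A : set T} {B : set U} (f : T -> U) :
  (forall x, A x -> B (f x)) -> (forall x y, A x -> A y -> f x = f y -> x = y) ->
  A #<= B.
Proof.
move=> fAB finj.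
have /injfunPex[g] : exists2 f : T -> U, set_fun A B f & set_inj A f.
  by exists f => // x y /set_mem Ax /set_mem Ay; exact: finj.
exact: inj_card_le.
Qed.

(** The point [u] is the value taken outside [A], so that the injection is a plain function
    [T -> U]. *)
Lemma card_le_ex_inj {T U : Type} {A : set T} {B : set U} (u : U) : A #<= B ->
  exists2 f : T -> U, (forall x, A x -> B (f x)) &
    forall x y, A x -> A y -> f x = f y -> x = y.
Proof.
move=> /card_leP[f].
have /injfunPex[g gAB ginj] : $|{injfun A >-> B}| by squash (valLR u f).
by exists g => // x y Ax Ay; apply: ginj; apply/mem_set.
Qed.

(** Choice turns [G] into a function. This is how a graph found by Zorn's lemma, or its converse,
    gives a cardinal inequality. *)
Lemma card_le_rel {T U : Type} {A : set T} {B : set U} (G : T -> U -> Prop) :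
  (forall x, A x -> exists2 u, B u & G x u) ->
  (forall x y u, A x -> A y -> G x u -> G y u -> x = y) -> A #<= B.
Proof.
move=> GAB Ginj; have [->//|/set0P[a /GAB[b _ _]]] := eqVneq A set0.
have /choice[f fP] x : exists u, A x -> B u /\ G x u.
  by have [/GAB[u]|?] := pselect (A x); [exists u|exists b].
apply: (card_le_of_inj (f := f)) => [x /fP[]//|x y Ax Ay fxy].
apply: (Ginj _ _ (f x)) => //; first by have [] := fP x Ax.
by rewrite fxy; have [] := fP y Ay.
Qed.

(* A maximal partial injection from D to A defined on an initial segment of D
   either is total on D or has range A. *)
Lemma card_le_or_initial_segment {T U : Type} (le : rel T) (D : set T)
    (A : set U) : well_order le ->
  D #<= A \/ exists2 x, D x & A #<= D `&` initial_segment le x.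
Proof.
move=> wo.
pose P (G : set (T * U)) := [/\
  forall x y u, G (x, u) -> G (y, u) -> x = y,
  forall x u v, G (x, u) -> G (x, v) -> u = v,
  forall x u, G (x, u) -> D x /\ A u &
  forall x y u, G (x, u) -> D y -> le y x -> exists v, G (y, v)].
have [F FP Ftot|G [[Ginj Gfun GDA Gdown] Gmax]] := @Zorn_bigcup _ P.
  have common p q : (\bigcup_(H in F) H) p -> (\bigcup_(H in F) H) q ->
      exists H, [/\ P H, H p & H q].
    move=> [H1 FH1 H1p] [H2 FH2 H2q].
    have [H12|H21] := Ftot _ _ FH1 FH2.
    - by exists H2; split; [exact: FP|exact: H12|].
    - by exists H1; split; [exact: FP| |exact: H21].
  split.
  - by move=> x y u /common/[apply] -[H [[+ _ _ _]]]; exact.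
  - by move=> x u v /common/[apply] -[H [[_ + _ _]]]; exact.
  - by move=> x u [H /FP[_ _ + _]]; exact.
  - move=> x y u [H FH Hxu] Dy yx; have [_ _ _ down] := FP _ FH.
    by have [v Hyv] := down _ _ _ Hxu Dy yx; exists v, H.
have [Gtot|] := pselect (forall x, D x -> exists u, G (x, u)).
  left; apply: (card_le_rel (G := fun x u => G (x, u))).
  - by move=> x /Gtot[u Gxu]; exists u => //; case: (GDA _ _ Gxu).
  - by move=> x y u _ _; exact: Ginj.
move=> /existsNP[x0 /not_implyP[Dx0 nGx0]].
(* The domain of [G] lies strictly below [m]. So the converse of [G] embeds [A] there, unless some
   [u] in [A] is missed; then [(m, u)] could be added to [G]. *)
have [|m [Dm nGm] mmin] := @well_order_min _ _ wo
    [set x | D x /\ ~ exists u, G (x, u)]; first by exists x0.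
have domE x u : G (x, u) -> ~~ le m x.
  by move=> Gxu; apply/negP => mx; apply: nGm; exact: (Gdown _ _ _ Gxu).
right; exists m => //.
apply: (card_le_rel (G := fun u x => G (x, u))); last first.
  by move=> u v x _ _; exact: Gfun.
move=> u Au; apply: contrapT => nGu.
have {}nGu x : ~ G (x, u).
  move=> Gxu; apply: nGu; exists x => //; split; last exact: domE Gxu.
  by case: (GDA _ _ Gxu).
apply: (Gmax (G `|` [set (m, u)])).
  split; last first.
    by move=> GU; apply: (nGu m); apply: GU; right.
  by move=> p; left.
split.
- move=> x y v [Gxv|[xm vu]] [Gyv|[ym wu]]; first exact: Ginj Gxv Gyv.
  + by case: (nGu x); rewrite -wu.
  + by case: (nGu y); rewrite -vu.
  + by rewrite xm ym.
- move=> x v w [Gxv|[xm vu]] [Gxw|[xm' wu]]; first exact: Gfun Gxv Gxw.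
  + by case: nGm; exists v; rewrite -xm'.
  + by case: nGm; exists w; rewrite -xm.
  + by rewrite vu wu.
- by move=> x v [/GDA//|[-> ->]].
- move=> x y v [Gxv|[-> _]] Dy yx.
    by have [w Gyw] := Gdown _ _ _ Gxv Dy yx; exists w; left.
  have [[w Gyw]|nGy] := pselect (exists w, G (y, w)); first by exists w; left.
  exists u; right; congr pair; apply: (well_order_antisym wo).
  by rewrite yx mmin.
Qed.

Lemma card_le_total {T U : Type} (A : set T) (B : set U) :
  A #<= B \/ B #<= A.
Proof.
elim/Pchoice : T => T in A *.
have [le wo] := well_ordering_principle T.
have [AB|[x _ BA]] := card_le_or_initial_segment A B wo; [by left|right].
by apply: card_le_trans BA _; apply: subset_card_le => y [].
Qed.

(* A maximal injection from B * B to B with B a subset of A has card B = card A: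
   otherwise A contains a copy C of B disjoint from B, and the injection extends
   to (B + C) * (B + C). Graphs are forced to contain S so that B is infinite. *)
Lemma card_le_square {T : Type} (A : set T) : infinite_set A -> A `*` A #<= A.
Proof.
move=> /infiniteP Ainf.
have [->|/set0P[a0 _]] := eqVneq A set0; first by rewrite set0X.
have [e eA einj] := card_le_ex_inj a0 Ainf.
have {}eA n : A (e n) by exact: eA.
have {}einj m n : e m = e n -> m = n by exact: einj.
(* A triple [(x, y, z)] says that [z] is a code of the pair [(x, y)]. [S] is the pairing of nat
   carried to [A] by [e]. *)
pose S : set (T * T * T) :=
  [set p | exists i j, p = (e i, e j, e (pickle (i, j)))].
(* A graph on [B * B] determines [B] through the diagonal. *)
pose dom (G : set (T * T * T)) : set T := [set x | exists z, G (x, x, z)].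
pose Q (G : set (T * T * T)) := [/\
  forall x y, dom G x -> dom G y -> exists z, G (x, y, z),
  forall x y z, G (x, y, z) -> [/\ dom G x, dom G y & dom G z],
  forall x y z, G (x, y, z) -> A x &
  forall x y x' y' z, G (x, y, z) -> G (x', y', z) -> x = x' /\ y = y'].
have domS i : dom S (e i) by exists (e (pickle (i, i))), i, i.
have QS : Q S.
  split.
  - by move=> x y [_ [i [_ [-> _ _]]]] [_ [j [_ [-> _ _]]]]; eexists; exists i, j.
  - by move=> _ _ _ [i [j [-> -> ->]]].
  - by move=> _ _ _ [i [j [-> _ _]]].
  - move=> _ _ _ _ _ [i [j [-> -> ->]]] [i' [j' [-> -> /einj]]].
    by move=> /(pcan_inj pickleK)[-> ->].
(* Adjoining [S] inside the condition also settles the empty chain, whose union is empty, by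
   [QS]. *)
have [F FQ Ftot|G [QH Gmax]] := @Zorn_bigcup _ (fun G => Q (S `|` G)).
  pose V := S `|` \bigcup_(H in F) H.
  have common p q : V p -> V q ->
      exists H, [/\ Q H, H `<=` V, H p & H q].
    have SV H : F H -> S `|` H `<=` V.
      by move=> FH r [Sr|Hr]; [left|right; exists H].
    move=> [Sp|[H1 FH1 H1p]] [Sq|[H2 FH2 H2q]].
    - by exists S; split => //; move=> r; left.
    - by exists (S `|` H2); split; [exact: FQ|exact: SV|left|right].
    - by exists (S `|` H1); split; [exact: FQ|exact: SV|right|left].
    - have [H12|H21] := Ftot _ _ FH1 FH2.
      + exists (S `|` H2); split; [exact: FQ|exact: SV|right|by right].
        exact: H12.
      + exists (S `|` H1); split; [exact: FQ|exact: SV|by right|right].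
        exact: H21.
  have domV H x : H `<=` V -> dom H x -> dom V x.
    by move=> HV [z /HV]; exists z.
  split.
  - move=> x y [z Vz] [w Vw]; have [H [[Htot _ _ _] HV Hz Hw]] := common _ _ Vz Vw.
    by have [||v /HV] := Htot x y; [exists z|exists w|exists v].
  - move=> x y z Vz; have [H [[_ + _ _] HV Hz _]] := common _ _ Vz Vz.
    by move=> /(_ _ _ _ Hz)[? ? ?]; split; exact: (domV H).
  - move=> x y z Vz; have [H [[_ _ + _] HV Hz _]] := common _ _ Vz Vz.
    by move=> /(_ _ _ _ Hz).
  - move=> x y x' y' z Vz Vw; have [H [[_ _ _ Hinj] _ Hz Hw]] := common _ _ Vz Vw.
    exact: Hinj Hz Hw.
set H := S `|` G in QH; case: (QH) => Htot Hdom HA Hinj.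
pose B := dom H.
have BA : B `<=` A by move=> x [z /HA].
have Be i : B (e i) by have [z Sz] := domS i; exists z; left.
have /choice[f fP] (p : T * T) : exists z, B p.1 -> B p.2 -> H (p.1, p.2, z).
  have [[Bx By]|nB] := pselect (B p.1 /\ B p.2).
    by have [z Hz] := Htot _ _ Bx By; exists z.
  by exists a0 => Bx By; case: nB.
have fB x y : B x -> B y -> B (f (x, y)).
  by move=> Bx By; case: (Hdom _ _ _ (fP (x, y) Bx By)).
have finj x y x' y' : B x -> B y -> B x' -> B y' -> f (x, y) = f (x', y') ->
    x = x' /\ y = y'.
  move=> Bx By Bx' By' ff; apply: (Hinj _ _ _ _ _ (fP (x, y) Bx By)).
  by rewrite ff; exact: (fP (x', y')).
have [/(card_le_ex_inj a0)[g gB ginj]|/(card_le_ex_inj a0)[h hAB hinj]] :=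
    card_le_total (A `\` B) B.
  (* Pairing with [e 0] or [e 1] sends [B] and the rest of [A] to disjoint parts of [B]. *)
  have [k kB kinj] : exists2 k : T -> T, (forall x, A x -> B (k x)) &
      forall x y, A x -> A y -> k x = k y -> x = y.
    exists (fun x => if pselect (B x) then f (e 0, x) else f (e 1, g x)) => [x Ax|].
      by case: pselect => Bx; apply: fB => //; apply: gB.
    move=> x y Ax Ay; case: pselect => Bx; case: pselect => By ff.
    - by have [||||] := finj _ _ _ _ _ _ _ _ ff.
    - have [||||/einj//] := finj _ _ _ _ _ _ _ _ ff => //; exact: gB.
    - have [||||/einj//] := finj _ _ _ _ _ _ _ _ ff => //; exact: gB.
    - have [||||_ gg] := finj _ _ _ _ _ _ _ _ ff; do ?[exact: gB|exact: Be].
      exact: ginj gg.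
  apply: (card_le_of_inj (f := fun p => f (k p.1, k p.2))) => [[x y] /= [Ax Ay]|].
    by apply: BA; apply: fB; apply: kB.
  move=> [x y] [x' y'] /= [Ax Ay] [Ax' Ay'] ff.
  have [||||/kinj xx /kinj yy] := finj _ _ _ _ _ _ _ _ ff; try exact: kB.
  by rewrite (xx Ax Ax') (yy Ay Ay').
have hA x : B x -> A (h x) by move=> /hAB[].
have hnB x : B x -> ~ B (h x) by move=> /hAB[].
pose C := h @` B.
(* [r] is the identity on [B] and inverts [h] on [C]; elsewhere its value in [B] is irrelevant. *)
have /choice[r rP] x : exists y, B y /\ ((B x \/ C x) -> x = y \/ x = h y).
  have [Bx|nBx] := pselect (B x); first by exists x; split => // _; left.
  have [[y By <-]|nCx] := pselect (C x); first by exists y; split => // _; right.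
  by exists (e 0); split => // -[].
have rB x : B (r x) by case: (rP x).
have rBE x : B x -> x = r x.
  move=> Bx; have [|//|xh] := (rP x).2; first by left.
  by case: (hnB (r x)) => //; rewrite -xh.
have rCE x : C x -> x = h (r x).
  move=> Cx; have [|xr|//] := (rP x).2; first by right.
  by case: Cx => y By hy; case: (hnB _ By); rewrite hy xr.
(* For a pair not inside [B * B], the tag tells which coordinates lie in [B]. Together with [r x]
   and [r y] it recovers the pair. *)
pose tag x y := if pselect (B x) then e 0 else if pselect (B y) then e 1 else e 2.
have tagB x y : B (tag x y).
  by rewrite /tag; case: pselect => ?; last case: pselect => ?; exact: Be.
have tagP x y : [\/ tag x y = e 0 /\ B x, [/\ tag x y = e 1, ~ B x & B y] |
    [/\ tag x y = e 2, ~ B x & ~ B y]].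
  rewrite /tag; case: pselect => Bx; first by apply: Or31.
  by case: pselect => By; [apply: Or32|apply: Or33].
(* Applying [h] puts the new codes in [C], away from the old ones in [B]. *)
pose new x y := h (f (tag x y, f (r x, r y))).
pose N : set (T * T * T) := [set p | [/\ B p.1.1 \/ C p.1.1, B p.1.2 \/ C p.1.2,
  ~ (B p.1.1 /\ B p.1.2) & p.2 = new p.1.1 p.1.2]].
have Cnew x y : C (new x y).
  by exists (f (tag x y, f (r x, r y))) => //; apply: (fB) => //; exact: fB.
have nBC x : B x -> C x -> False by move=> Bx [y /hnB + yx]; rewrite yx.
have HNE : S `|` (G `|` N) = H `|` N by rewrite setUA.
have domE x : dom (H `|` N) x <-> B x \/ C x.
  split=> [[z [Hz|[/= Bx _ _ _]]]|[[z Hz]|Cx]].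
  - by left; exists z.
  - by [].
  - by exists z; left.
  - exists (new x x); right; split => //=; [by right|by right|].
    by move=> [Bx _]; exact: nBC Bx Cx.
(* The extension is proper: otherwise [h (e 0)], a point of [C], would lie in [B]. *)
exfalso; apply: (Gmax (G `|` N)).
  split; first by move=> p; left.
  move=> NG; pose c := h (e 0).
  have Cc : C c by exists (e 0).
  have : G (c, c, new c c).
    apply: NG; right; split => //=; [by right|by right|].
    by move=> [Bc _]; exact: nBC Bc Cc.
  by move=> Gc; apply: (nBC c) => //; exists (new c c); right.
rewrite HNE; split.
- move=> x y /domE Dx /domE Dy.
  have [[Bx By]|nB] := pselect (B x /\ B y).
    by have [z Hz] := Htot _ _ Bx By; exists z; left.
  by exists (new x y); right.
- move=> x y z [/Hdom[? ? ?]|[/= Dx Dy _ ->]].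
    by split; apply/domE; left.
  by split; apply/domE => //; right.
- move=> x y z [/HA//|[/= [/BA//|[u Bu <-]] _ _ _]]; exact: hA.
- move=> x y x' y' z [Hz|[/= Dx Dy nB ->]] [Hz'|[/= Dx' Dy' nB' zE]].
  + exact: Hinj Hz Hz'.
  + by case: (nBC z); [case: (Hdom _ _ _ Hz)|rewrite zE].
  + by case: (nBC (new x y)); [case: (Hdom _ _ _ Hz')|].
  have tB u v w t : B (f (tag u v, f (r w, r t))) by apply: (fB) => //; exact: fB.
  move: zE => /hinj -/(_ (tB _ _ _ _) (tB _ _ _ _)) ff.
  have [||||tt {}ff] := finj _ _ _ _ _ _ _ _ ff; try exact: tagB; try exact: fB.
  have [||||rx ry] := finj _ _ _ _ _ _ _ _ ff; try exact: rB.
  have [xB yB] : (B x <-> B x') /\ (B y <-> B y').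
    by case: (tagP x y) (tagP x' y') => [[tE ?]|[tE ? ?]|[tE ? ?]]
      [[tE' ?]|[tE' ? ?]|[tE' ? ?]]; move: tt; rewrite tE tE';
      try (by move=> /einj); move=> _;
      split; split=> ? //; by [case: nB|case: nB'].
  have inv u v : (B u <-> B v) -> B u \/ C u -> B v \/ C v -> r u = r v -> u = v.
    move=> uv [Bu|Cu] [Bv|Cv] ruv.
    + by rewrite (rBE u)// (rBE v)// ruv.
    + by case: (nBC v) => //; apply/uv.
    + by case: (nBC u) => //; apply/uv.
    + by rewrite (rCE u)// (rCE v)// ruv.
  by split; exact: inv.
Qed.

Lemma card_le_setX {T T' U U' : Type} (A : set T) (B : set U) (A' : set T')
    (B' : set U') : A #<= A' -> B #<= B' -> A `*` B #<= A' `*` B'.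
Proof.
have [->|/set0P[a Aa]] := eqVneq A' set0.
  by rewrite card_le0 => /eqP->; rewrite set0X.
have [->|/set0P[b Bb]] := eqVneq B' set0.
  by rewrite card_le0 => _ /eqP->; rewrite setX0.
move=> /(card_le_ex_inj a)[f fA finj] /(card_le_ex_inj b)[g gB ginj].
apply: (card_le_of_inj (f := fun p => (f p.1, g p.2))) => [[x y]|[x y] [x' y']] /=.
  by move=> [/fA ? /gB].
by move=> [Ax By] [Ax' By'] [/finj -> // /ginj ->].
Qed.

(* The fibres of size less than kappa are bounded by initial segments, and the
   bounds of fewer than cf kappa of them are bounded, say by x; so kappa would
   have at most |I| * |initial_segment x| elements. *)
Lemma cofinality_pigeonhole {kappa J U V : Type} (le : rel kappa) (C : set U)
    (I : set J) (Y : set V) (d : V -> J) :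
  is_cardinal le -> cf_eq le C -> infinite_set I -> card_lt I C ->
  Y #= [set: kappa] -> (forall y, Y y -> I (d y)) ->
  exists2 i, I i & Y `&` d @^-1` [set i] #= Y.
Proof.
move=> [wo initial] [[K Kcof KC] cfC] Iinf [_ nCI] Yk dI.
have cof_nle (S : set kappa) : S #<= I -> ~ cofinal le S.
  by move=> SI /cfC CS; move/negP: nCI; apply; exact: card_le_trans CS SI.
have nle_seg x : ~ ([set: kappa] #<= initial_segment le x).
  move=> kx; move/negP: (initial x); apply.
  by rewrite card_eq_le kx card_leT.
(* All of [kappa] is cofinal in itself. *)
have nkI : ~ ([set: kappa] #<= I).
  by move=> /cof_nle; apply => x; exists x => //; exact: well_order_refl.
have /set0P[x0 _] : [set: kappa] != set0.
  by apply/eqP => k0; apply: nkI; rewrite k0; exact: card_ge0.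
apply: contrapT => nfib.
have bound i : exists x, I i ->
    Y `&` d @^-1` [set i] #<= initial_segment le x.
  have [Ii|nIi] := pselect (I i); last by exists x0.
  have [kY|[x _]] :=
      card_le_or_initial_segment [set: kappa] (Y `&` d @^-1` [set i]) wo.
    case: nfib; exists i => //; rewrite card_eq_le (card_le_eql Yk) kY andbT.
    by apply: subset_card_le => y [].
  by rewrite setTI; exists x.
have {bound}/choice[b bP] := bound.
have [x xb] : exists x, forall i, I i -> ~~ le x (b i).
  apply: contrapT => nb; apply: (cof_nle (b @` I)); first exact: card_image_le.
  move=> x; apply: contrapT => nx; apply: nb; exists x => i Ii.
  by apply/negP => xi; apply: nx; exists (b i) => //; exists i.
have {}bP i : I i -> Y `&` d @^-1` [set i] #<= initial_segment le x.
  move=> Ii; apply: card_le_trans (bP i Ii) _; apply: subset_card_le => z /= bz.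
  have /orP[xbi|bx] := well_order_total wo x (b i); first by move/negP: (xb i Ii).
  by apply: contra bz; exact: well_order_trans bx.
have kIx : [set: kappa] #<= I `*` initial_segment le x.
  rewrite -(card_le_eql Yk).
  have /choice[g gP] i : exists g : V -> kappa, I i ->
      (forall y, (Y `&` d @^-1` [set i]) y -> initial_segment le x (g y)) /\
      forall y z, (Y `&` d @^-1` [set i]) y -> (Y `&` d @^-1` [set i]) z ->
        g y = g z -> y = z.
    have [/bP/(card_le_ex_inj x0)[g]|nIi] := pselect (I i); first by exists g.
    by exists (fun=> x0).
  apply: (card_le_of_inj (f := fun y => (d y, g (d y) y))) => [y Yy|y z Yy Yz].
    by split; [exact: dI|exact: (gP (d y) (dI y Yy)).1].
  move=> [dyz]; rewrite -dyz; exact: (gP (d y) (dI y Yy)).2.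
(* The larger factor is infinite because [I] is, so it absorbs the product; yet neither factor has
   room for [kappa]. *)
have [Ix|xI] := card_le_total I (initial_segment le x).
  apply: (nle_seg x); apply: card_le_trans kIx _.
  apply: card_le_trans (card_le_square _); first exact: card_le_setX.
  by move=> /card_le_finite - /(_ _ _ Ix).
apply: nkI; apply: card_le_trans kIx _; apply: card_le_trans (card_le_square Iinf).
exact: card_le_setX.
Qed.

End CardinalArithmetic.

(** * Linear density and functionals in Banach spaces *)

Section BanachSpaces.
Context {R : realType}.
Local Open Scope classical_set_scope.
Local Open Scope card_scope.
Local Open Scope ring_scope.
Implicit Type X : completeNormedModType R.

(** Finite rational combinations of a sequence running through [D] are countably many, and
    approximate the real ones term by term. *)
Lemma countable_linearly_dense_separable X (D : set X) :
  countable D -> linearly_dense D -> separable X.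
Proof.
move=> /countable_injP[f finj] Ddense.
(* [e] inverts [f] on [D]; its values off the image of [D] do not matter. *)
have /choice[e eP] n : exists x, forall y, D y -> f y = n -> x = y.
  have [[x [Dx fx]]|nx] := pselect (exists x, D x /\ f x = n).
    by exists x => y Dy fy; apply: finj; rewrite ?inE// fx fy.
  by exists 0 => y Dy fy; case: nx; exists y.
pose comb (s : seq (rat * nat)) : X := \sum_(p <- s) ratr p.1 *: e p.2.
exists (range comb).
  exact: sub_countable (card_image_le _ _) (countableP _).
have approx (x : X) : linear_span D x ->
    forall eps, 0 < eps -> exists s, `|x - comb s| < eps.
  move=> [n [a [v [Dv ->]]]]; elim/big_ind : _ => //.
  - by move=> eps eps0; exists [::]; rewrite /comb big_nil subrr normr0.
  - move=> y z ya za eps eps0; have eps20 : 0 < eps / 2 by rewrite divr_gt0.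
    have [s ys] := ya _ eps20; have [t zt] := za _ eps20.
    exists (s ++ t); rewrite /comb big_cat/= opprD addrACA (splitr eps).
    by rewrite (le_lt_trans (ler_normD _ _))// ltrD.
  - move=> i _ eps eps0; pose u := e (f (v i)).
    (* The [+ 1] keeps the denominator positive when [u] is zero. *)
    have d0 : 0 < eps / (`|u| + 1) by rewrite divr_gt0// ltr_wpDl.
    have : a i < a i + eps / (`|u| + 1) by rewrite ltrDl.
    move=> /rat_in_itvoo[q]; rewrite in_itv /= => /andP[aq qa].
    exists [:: (q, f (v i))]; rewrite /comb big_seq1/= -/u.
    have -> : v i = u by rewrite /u (eP _ (v i)).
    rewrite -scalerBl normrZ distrC ger0_norm ?subr_ge0 ?ltW//.
    rewrite (@le_lt_trans _ _ (eps / (`|u| + 1) * `|u|))//.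
      by rewrite ler_wpM2r// lerBlDl ltW.
    by rewrite mulrAC -mulrA gtr_pMr// ltr_pdivrMr ?mul1r ?ltrDl// ltr_wpDl.
move=> O O0 oO; have [x [Ox /approx xa]] := Ddense O O0 oO.
have /nbhs_ballP[eps /= eps0 epsO] : nbhs x O by exact: open_nbhs_nbhs.
have [s xs] := xa _ eps0; exists (comb s); split; last by exists s.
by apply: epsO; rewrite -ball_normE.
Qed.

(** The points where [d] is nonzero form a nonempty open set that misses the span of [Z]. *)
Lemma kernel_not_linearly_dense X (d : dual X) (Z : set X) :
  d <> 0 -> (forall x, Z x -> d x = 0) -> ~ linearly_dense Z.
Proof.
move=> d0 Zd Zdense.
have [||x [/= dx [n [a [v [Zv xE]]]]]] := Zdense (d @^-1` [set r : R^o | r != 0]).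
- apply: contrapT => nd; apply: d0; apply/val_inj/funext => x /=.
  by apply: contrapT => /eqP dx; apply: nd; exists x.
- apply: open_comp; first by move=> x _; exact: dual_continuous.
  exact: open_neq.
move: dx; rewrite xE linear_sum big1 ?eqxx// => i _.
by rewrite linearZ /= Zd// scaler0.
Qed.

(** The norm of [x] bounds evaluation at [x]. The countability condition of [WLD W], which concerns
    functionals on [W], thus applies to points of [X]. *)
Lemma evaluation_dual X (W : closed_subspace (dual X)) (x : X) :
  exists f : dual W, forall w : W, f w = subspace_val w x.
Proof.
pose ev (w : W) : R^o := subspace_val w x.
have evl : linear ev by [].
pose L : {linear W -> R^o} := HB.pack ev (GRing.isLinear.Build _ _ _ _ ev evl).
have evc : continuous ev.
  apply: (@bounded_linear_continuous _ _ _ L); apply/linear_boundedP.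
  near=> r => w; rewrite (le_trans (le_dual_norm (subspace_val w) x))//.
  rewrite mulrC; apply: (@ler_wpM2r _ `|w| (normr_ge0 w)).
  by near: r; apply: nbhs_pinfty_ge; rewrite num_real.
have evP : ev \in dual_pred W by apply/asboolP.
by exists (Dual evP).
Unshelve. all: by end_near. Qed.

Lemma dens_eq_card X (S T : Type) (A : set S) (B : set T) :
  dens_eq X A -> dens_eq X B -> A #= B.
Proof.
move=> [[A' A'd A'A] Amin] [[B' B'd B'B] Bmin]; rewrite card_eq_le.
by rewrite -(card_le_eqr B'B) -(card_le_eqr A'A) Amin// Bmin.
Qed.

(** A WLD witness stays uncountable without [0], or the space would be separable. If it is too
    large, comparability embeds [omega1] in it; countability of supports passes to subsets. *)
Lemma nonseparable_WLD_subset X : ~ separable X -> WLD X -> exists D : set X,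
  [/\ ~ countable D, D #<= omega1, forall d, D d -> d <> 0 &
      forall f : dual X, countable [set d | D d /\ f d <> 0]].
Proof.
move=> nsep [D Ddense Df]; pose E := D `\ 0.
have nE : ~ countable E.
  move=> cE; apply: nsep; apply: (countable_linearly_dense_separable _ Ddense).
  have : countable (E `|` [set 0]).
    rewrite -bigcup2E; apply: bigcup_countable => // -[|[|n]] _.
    - exact: cE.
    - exact: countable1.
    - exact: countable0.
  apply: sub_countable; apply: subset_card_le => d Dd.
  by have [->|/eqP d0] := eqVneq d 0; [right|left; split].
have [F [FE nF Fo]] : exists F, [/\ F `<=` E, ~ countable F & F #<= omega1].
  have [Eo|/(card_le_ex_inj 0)[g gE ginj]] := card_le_total E omega1.
    by exists E; split.
  have go : g @` omega1 #= omega1.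
    by apply: inj_card_eq => a b /set_mem ? /set_mem ?; exact: ginj.
  exists (g @` omega1); split; first by move=> _ [a /gE ? <-].
  - by rewrite (eq_countable go); exact: omega1_uncountable.
  - by rewrite (card_le_eql go).
exists F; split => // [d /FE[]//|f].
by apply: sub_countable (Df f); apply: subset_card_le => d [/FE[]].
Qed.

End BanachSpaces.

Theorem theorem38 (R : realType) (kappa : Type) (le_kappa : rel kappa)
  (kappa_card : is_cardinal le_kappa)
  (cf_kappa : exists2 C : set kappa, cf_eq le_kappa C & card_lt omega1 C)
  (X : completeNormedModType R)
  (X_infdim : infinite_dimensional X)
  (dens_X : dens_eq X [set: kappa]%classic)
  (W : closed_subspace (dual X))
  (W_nonsep : ~ separable W)
  (W_WLD : WLD W) :
  ~ exists Y : set X, overcomplete Y.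
Proof.
move=> [Y [densY Ydense]]; have [C cfC [oC nCo]] := cf_kappa.
have [D [nD Do D0 Df]] := nonseparable_WLD_subset W_nonsep W_WLD.
(* If no [w] in [D] vanished at [x], evaluation at [x] would be nonzero on all of the uncountable
   [D]. *)
have /choice[d dP] (x : X) : exists w : W, D w /\ subspace_val w x = 0%R.
  have [f fE] := evaluation_dual W x.
  apply: contrapT => nx; apply: nD; apply: sub_countable (Df f).
  apply: subset_card_le => w Dw; split => // fw; apply: nx.
  by exists w; rewrite -fE.
have Dinf : ~ finite_set D by move=> /finite_set_countable.
have DC : card_lt D C.
  split; first exact: card_le_trans Do oC.
  by apply: contra nCo => CD; exact: card_le_trans CD Do.
have [w Dw YZ] := cofinality_pigeonhole kappa_card cfC Dinf DC
  (dens_eq_card densY dens_X) (fun y _ => (dP y).1).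
apply: (@kernel_not_linearly_dense _ _ (subspace_val w) _ _ _ (Ydense _ _ YZ)).
- by move=> w0; apply: (D0 w Dw); exact: val_inj.
- by move=> y [_ <-]; exact: (dP y).2.
- by move=> y [].
Qed.
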